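(* Consider the one-dimensional Chew–Goldberger–Low (CGL) system in primitive variables $\mathbf{W}=(\rho,u_x,u_y,u_z,p_\parallel,p_\perp,B_y,B_z)$, with constant $B_x\in\mathbb{R}$, whose quasilinear matrix $\mathbf{A}(\mathbf{W})$ is given in the context. The characteristic fields corresponding to the entropy wave $u_x$, the pressure anisotropy wave $u_x$, and the Alfvén waves $u_x\pm c_a$ are linearly degenerate, i.e. $\nabla\lambda(\mathbf{W})\cdot R(\mathbf{W})=0$ for all $\mathbf{W}\in\Omega$, for each of the following pairs of an eigenvalue $\lambda$ of $\mathbf{A}$ and associated right eigenvector $R$: (1) the entropy wave, $\lambda=u_x$, with $R=R^e_{u_x}=(1,0,0,0,0,0,0,0)^\top$; (2) the pressure anisotropy wave, $\lambda=u_x$, with $R=R^p_{u_x}=\left(0,0,0,0,(1-b_x^2)\Delta p,\; b_x^2\Delta p-\frac{|\boldsymbol{B}|^2}{4\pi},\; B_y,\; B_z\right)^\top$; (3)–(4) the two Alfvén waves, $\lambda=u_x\pm c_a$ with $c_a=\sqrt{\frac{B_x^2}{4\pi\rho}-\frac{(\Delta p)\,b_x^2}{\rho}}$, with $$R=R_{u_x\pm c_a}=\left(0,\,0,\;\pm b_z\,\mathrm{sgn}(B_x)\sqrt{\tfrac{|\boldsymbol{B}|^2}{4\pi\rho}-\tfrac{\Delta p}{\rho}},\;\mp b_y\,\mathrm{sgn}(B_x)\sqrt{\tfrac{|\boldsymbol{B}|^2}{4\pi\rho}-\tfrac{\Delta p}{\rho}},\;0,\,0,\,-B_z,\,B_y\right)^\top,$$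 where the upper signs correspond to $u_x+c_a$ and the lower signs to $u_x-c_a$.
   Context: Notation. $\rho$ is the density, $(u_x,u_y,u_z)$ the velocity, $p_\parallel,p_\perp$ the parallel and perpendicular scalar pressure components, $\boldsymbol{B}=(B_x,B_y,B_z)$ the magnetic field with $|\boldsymbol{B}|^2=B_x^2+B_y^2+B_z^2$; $B_x$ is a fixed constant (a parameter, not one of the unknowns). Put $\boldsymbol{b}=(b_x,b_y,b_z)=\boldsymbol{B}/|\boldsymbol{B}|$ and $\Delta p=p_\parallel-p_\perp$; $\mathrm{sgn}$ is the sign function. The gradient $\nabla$ is taken with respect to the eight variables $\mathbf{W}=(\rho,u_x,u_y,u_z,p_\parallel,p_\perp,B_y,B_z)$, in this order ($b_x,b_y,b_z,|\boldsymbol{B}|$ depend on $B_y,B_z$). The one-dimensional CGL system in quasilinear form is, up to a source term containing no derivatives, $\partial_t\mathbf{W}+\mathbf{A}(\mathbf{W})\,\partial_x\mathbf{W}=0$ with $$\mathbf{A}=\begin{pmatrix} u_x & \rho & 0 & 0 & 0 & 0 & 0 & 0\\ 0 & u_x & 0 & 0 & \frac{b_x^2}{\rho} & \frac{1-b_x^2}{\rho} & \frac{B_y}{4\pi\rho}-\frac{2b_x^2b_y\Delta p}{\rho|\boldsymbol{B}|} & \frac{B_z}{4\pi\rho}-\frac{2b_x^2b_z\Delta p}{\rho|\boldsymbol{B}|}\\ 0 & 0 & u_x & 0 & \frac{b_xb_y}{\rho} & -\frac{b_xb_y}{\rho} & \frac{b_x(1-2b_y^2)\Delta p}{\rho|\boldsymbol{B}|}-\frac{B_x}{4\pi\rho}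 & \frac{-2b_xb_yb_z\Delta p}{\rho|\boldsymbol{B}|}\\ 0 & 0 & 0 & u_x & \frac{b_xb_z}{\rho} & -\frac{b_xb_z}{\rho} & \frac{-2b_xb_yb_z\Delta p}{\rho|\boldsymbol{B}|} & \frac{b_x(1-2b_z^2)\Delta p}{\rho|\boldsymbol{B}|}-\frac{B_x}{4\pi\rho}\\ 0 & p_\parallel(1+2b_x^2) & 2p_\parallel b_xb_y & 2p_\parallel b_xb_z & u_x & 0 & 0 & 0\\ 0 & p_\perp(2-b_x^2) & -p_\perp b_xb_y & -p_\perp b_xb_z & 0 & u_x & 0 & 0\\ 0 & B_y & -B_x & 0 & 0 & 0 & u_x & 0\\ 0 & B_z & 0 & -B_x & 0 & 0 & 0 & u_x \end{pmatrix}.$$ Solution set. $\Omega$ is the set of states with $\rho>0$, $p_\parallel>0$, $p_\perp>0$ and $P_m\le p_\parallel\le P_M$, where $$P_m=\frac{p_\perp^2}{6p_\perp+\frac{3|\boldsymbol{B}|^2}{4\pi}},\qquad P_M=\frac{|\boldsymbol{B}|^2}{4\pi}+p_\perp .$$ Definition (linear degeneracy). A characteristic field with eigenvalue $\lambda_i(\mathbf{W})$ and right eigenvector $R_i(\mathbf{W})$ is said to be linearly degenerate if $\nabla\lambda_i(\mathbf{W})\cdot R_i(\mathbf{W})=0$ for all $\mathbf{W}\in\Omega$.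
   Formalization: The vectors are claimed to be eigenvectors only where nonzero (Alfvén: not B_y=B_z=0; anisotropy: not B_y=B_z=0 with p_∥=P_M); at p_∥=P_M with B_x≠0, c_a is not differentiable and non-existent derivatives count as 0; b=0 where B=0. *)

(* Defs.v *)
From HB Require Import structures.
From mathcomp Require Import all_boot all_order all_algebra.
From mathcomp Require Import all_classical all_reals all_analysis.
Set Implicit Arguments.
Unset Strict Implicit.
Unset Printing Implicit Defensive.
Import Order.TTheory GRing.Theory Num.Theory.
Import numFieldNormedType.Exports.
Local Open Scope classical_set_scope.
Local Open Scope ring_scope.

Section CGL.
Context {R : realType}.

(* W = (rho, u_x, u_y, u_z, p_par, p_perp, B_y, B_z)^T *)
Notation state := 'cV[R]_8.

Definition rho (W : state) : R := W (@Ordinal 8 0 isT) 0.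
Definition ux (W : state) : R := W (@Ordinal 8 1 isT) 0.
Definition uy (W : state) : R := W (@Ordinal 8 2 isT) 0.
Definition uz (W : state) : R := W (@Ordinal 8 3 isT) 0.
Definition ppar (W : state) : R := W (@Ordinal 8 4 isT) 0.
Definition pperp (W : state) : R := W (@Ordinal 8 5 isT) 0.
Definition By (W : state) : R := W (@Ordinal 8 6 isT) 0.
Definition Bz (W : state) : R := W (@Ordinal 8 7 isT) 0.

Definition vec8 (s : seq R) : state := \col_(i < 8) s`_i.
Definition mat8 (rows : seq (seq R)) : 'M[R]_8 :=
  \matrix_(i < 8, j < 8) (nth [::] rows i)`_j.

Definition dp (W : state) : R := ppar W - pperp W.

Definition Bnorm (Bx : R) (W : state) : R :=
  Num.sqrt (Bx ^+ 2 + By W ^+ 2 + Bz W ^+ 2).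

(* Since 0^-1 = 0, b = 0 at the states where B = 0 (possible only if Bx = 0). *)
Definition bx (Bx : R) (W : state) : R := Bx / Bnorm Bx W.
Definition by_ (Bx : R) (W : state) : R := By W / Bnorm Bx W.
Definition bz (Bx : R) (W : state) : R := Bz W / Bnorm Bx W.

Definition cgl_matrix (Bx : R) (W : state) : 'M[R]_8 :=
  let r := rho W in let u := ux W in
  let pl := ppar W in let pt := pperp W in
  let By := By W in let Bz := Bz W in
  let N := Bnorm Bx W in let D := dp W in
  let bx := bx Bx W in let b_y := by_ Bx W in let bz := bz Bx W in
  mat8
  [:: [:: u; r; 0; 0; 0; 0; 0; 0];
      [:: 0; u; 0; 0; bx ^+ 2 / r; (1 - bx ^+ 2) / r;
          By / (4 * pi * r) - 2 * bx ^+ 2 * b_y * D / (r * N);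
          Bz / (4 * pi * r) - 2 * bx ^+ 2 * bz * D / (r * N)];
      [:: 0; 0; u; 0; bx * b_y / r; - (bx * b_y / r);
          bx * (1 - 2 * b_y ^+ 2) * D / (r * N) - Bx / (4 * pi * r);
          - 2 * bx * b_y * bz * D / (r * N)];
      [:: 0; 0; 0; u; bx * bz / r; - (bx * bz / r);
          - 2 * bx * b_y * bz * D / (r * N);
          bx * (1 - 2 * bz ^+ 2) * D / (r * N) - Bx / (4 * pi * r)];
      [:: 0; pl * (1 + 2 * bx ^+ 2); 2 * pl * bx * b_y; 2 * pl * bx * bz;
          u; 0; 0; 0];
      [:: 0; pt * (2 - bx ^+ 2); - (pt * bx * b_y); - (pt * bx * bz);
          0; u; 0; 0];
      [:: 0; By; - Bx; 0; 0; 0; u; 0];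
      [:: 0; Bz; 0; - Bx; 0; 0; 0; u]].

Definition P_m (Bx : R) (W : state) : R :=
  pperp W ^+ 2 / (6 * pperp W + 3 * Bnorm Bx W ^+ 2 / (4 * pi)).
Definition P_M (Bx : R) (W : state) : R :=
  Bnorm Bx W ^+ 2 / (4 * pi) + pperp W.

Definition Omega (Bx : R) : set state :=
  [set W | [/\ 0 < rho W, 0 < ppar W, 0 < pperp W &
               P_m Bx W <= ppar W <= P_M Bx W]].

Definition c_a (Bx : R) (W : state) : R :=
  Num.sqrt (Bx ^+ 2 / (4 * pi * rho W) - dp W * bx Bx W ^+ 2 / rho W).

(* The sign of the wave is s = 1 for u_x + c_a and s = -1 for u_x - c_a. *)
Definition alfven_speed (s Bx : R) (W : state) : R := ux W + s * c_a Bx W.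

Definition R_entropy (W : state) : state := vec8 [:: 1; 0; 0; 0; 0; 0; 0; 0].

Definition R_anisotropy (Bx : R) (W : state) : state :=
  vec8 [:: 0; 0; 0; 0; (1 - bx Bx W ^+ 2) * dp W;
           bx Bx W ^+ 2 * dp W - Bnorm Bx W ^+ 2 / (4 * pi); By W; Bz W].

Definition R_alfven (s Bx : R) (W : state) : state :=
  let q := Num.sqrt (Bnorm Bx W ^+ 2 / (4 * pi * rho W) - dp W / rho W) in
  vec8 [:: 0; 0; s * (bz Bx W * Num.sg Bx * q);
           - s * (by_ Bx W * Num.sg Bx * q); 0; 0; - Bz W; By W].

Definition right_eigenvector (A : 'M[R]_8) (a : R) (v : state) : Prop :=
  v != 0 /\ A *m v = a *: v.

Definition gradient (f : state -> R) (W : state) : 'rV[R]_8 :=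
  \row_(j < 8) 'D_(delta_mx j 0 : state) f W.

(* 'D_v f W is a total operator: it is meaningful as a derivative only where f
   is derivable, so uses of this predicate come with differentiability of lam.
   For lam = u_x +- c_a this fails at the boundary states of Omega with
   p_par = P_M and Bx != 0, where c_a is the square root of a quantity that
   vanishes. *)
Definition linearly_degenerate (Bx : R) (lam : state -> R)
    (Rv : state -> state) : Prop :=
  forall W, Omega Bx W -> gradient lam W *m Rv W = 0.

End CGL.

(* Main.v *)
Require Import Defs.
From HB Require Import structures.
From mathcomp Require Import all_boot all_order all_algebra.
From mathcomp Require Import all_classical all_reals all_analysis.
From mathcomp Require Import ring.
Import Order.TTheory GRing.Theory Num.Theory.
Import numFieldNormedType.Exports.
Local Open Scope classical_set_scope.
Local Open Scope ring_scope.

(** Why the fields are linearly degenerate. The eigenvalue of the entropy and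
anisotropy waves is the coordinate [ux], and neither eigenvector has a
component along it. The Alfven speed [ux + s * c_a] sees the magnetic field
only through [By ^+ 2 + Bz ^+ 2]. The components of its eigenvector that matter
here, [(- Bz, By)], are tangent to the circle on which this quantity is
constant: along the line [W + h *: R_alfven s Bx W] it equals
[(1 + h ^+ 2) * (By ^+ 2 + Bz ^+ 2)], and all other arguments of the speed stay
fixed. So the speed is an even function of [h] and its derivative at [h = 0]
vanishes, without any computation of the gradient ([derive_even],
[alfven_degenerate_smooth]).

This needs the speed to be differentiable, so that the gradient pairs with a
vector to the directional derivative ([gradient_mulmx]). Differentiability
fails at the states with [ppar = P_M] and [Bx != 0]. There [c_a] reaches its
minimum [0], hence every partial derivative of the speed except the one along
[ux] is [0]: either it exists and is [0] by Fermat's rule, or it does not exist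
and the total operator ['D_v] returns its default value [0] ([derive_at_min],
[alfven_derive_boundary]).

The eigenvector identities rest on the factorization [c_a = `|bx| * v], where
[v], the Alfven speed of a wave propagating along the field, is also the square
root in [R_alfven], together with [bx ^+ 2 + by_ ^+ 2 + bz ^+ 2 = 1] when the
field is nonzero ([c_a_eq], [dp_eq], [sqr_by_add_bz]). Where [R_alfven]
vanishes, that is for [By = Bz = 0], another vector with the same eigenvalue is
exhibited ([alfven_eigenvalue]). *)

(** * Directional derivatives that vanish *)

(** The limit of a divergent filter is the default point, which is [0] in a
field: only the case where the derivative exists has to be treated. *)
Lemma derive_eq0_of_derivable (R : realType) (V : normedModType R)
    (f : V -> R) (a v : V) :
  (derivable f a v -> 'D_v f a = 0) -> 'D_v f a = 0.
Proof.
by have [df|ndf] := pselect (derivable f a v); [exact | rewrite [LHS]dvgP].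
Qed.

(** Differentiability makes the derivative odd in the direction, evenness of
[f] about [a] makes it even in the direction. *)
Lemma derive_even (R : realType) (V : normedModType R) (f : V -> R) (a v : V) :
  differentiable f a -> (forall h, f (- (h *: v) + a) = f (h *: v + a)) ->
  'D_v f a = 0.
Proof.
move=> df even_f.
have : 'D_(- v) f a = 'D_v f a.
  rewrite /derive; set q := fun h => _; set q' := fun h => _.
  by have -> : q = q' by apply/funext => h; rewrite /q /q' /= scalerN even_f.
by rewrite !deriveE// linearN => /eqP; rewrite -subr_eq0 -opprD oppr_eq0
  -mulr2n mulrn_eq0 => /eqP.
Qed.

(** Fermat's rule, with no differentiability assumption: it holds for the total
operator ['D_v]. *)
Lemma derive_at_min (R : realType) (V : normedModType R) (f : V -> R)
    (a v : V) :
  (forall h, f a <= f (h *: v + a)) -> 'D_v f a = 0.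
Proof.
move=> fmin; apply: derive_eq0_of_derivable => df.
apply/eqP; rewrite eq_le; apply/andP; split.
  have dl := cvg_dnbhs_at_left df.
  rewrite /derive -(cvg_lim _ dl)//; apply: limr_le; first exact: cvgP dl.
  near=> h; apply: mulr_le0_ge0; last by rewrite subr_ge0 fmin.
  by rewrite invr_le0 ltW.
have dr := cvg_dnbhs_at_right df.
rewrite /derive -(cvg_lim _ dr)//; apply: limr_ge; first exact: cvgP dr.
near=> h; apply: mulr_ge0; last by rewrite subr_ge0 fmin.
by rewrite invr_ge0 ltW.
Unshelve. all: by end_near. Qed.

Lemma gradient_mulmx (R : realType) (f : 'cV[R]_8 -> R) (W v : 'cV[R]_8) :
  differentiable f W -> gradient f W *m v = ('D_v f W)%:M.
Proof.
move=> df; apply/matrixP => i j; rewrite !ord1 !mxE eqxx mulr1n.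
rewrite deriveE// [in RHS](matrix_sum_delta v) linear_sum.
apply: eq_bigr => k _; rewrite big_ord1 linearZ mxE deriveE//= mulrC.
by [].
Qed.

(** * Eigenvectors of explicit matrices *)

Lemma mat8_eigenvector (R : realType) (rows : seq (seq R)) (s : seq R) (a : R) :
  (forall i, (i < 8)%N ->
    let r := nth [::] rows i in
    r`_0 * s`_0 + r`_1 * s`_1 + r`_2 * s`_2 + r`_3 * s`_3
      + r`_4 * s`_4 + r`_5 * s`_5 + r`_6 * s`_6 + r`_7 * s`_7 = a * s`_i) ->
  mat8 rows *m vec8 s = a *: vec8 s.
Proof.
move=> rows_s; apply/colP => i; rewrite !mxE -rows_s//.
by rewrite !big_ord_recr big_ord0 /= add0r !mxE.
Qed.

Lemma vec8_neq0 (R : realType) (s : seq R) i :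
  (i < 8)%N -> s`_i != 0 -> vec8 s != 0.
Proof.
move=> i8; apply: contraNneq => /matrixP/(_ (Ordinal i8) 0).
by rewrite !mxE => /eqP.
Qed.

Lemma eigenvalue_tr (R : realType) (A : 'M[R]_8) (a : R) (v : 'cV[R]_8) :
  right_eigenvector A a v -> eigenvalue A^T a.
Proof.
move=> [v0 Av]; apply/eigenvalueP; exists v^T; last by rewrite trmx_eq0.
by rewrite -trmx_mul Av linearZ.
Qed.

(** * Direction of the magnetic field and Alfven speed *)

Section Field.
Context (R : realType) (Bx : R) (W : 'cV[R]_8).

Lemma sqr_Bnorm : Bnorm Bx W ^+ 2 = Bx ^+ 2 + By W ^+ 2 + Bz W ^+ 2.
Proof. by rewrite sqr_sqrtr// !addr_ge0// sqr_ge0. Qed.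

Lemma Bnorm_eq0 : (Bnorm Bx W == 0) = [&& Bx == 0, By W == 0 & Bz W == 0].
Proof.
rewrite -(sqrf_eq0 (Bnorm _ _)) sqr_Bnorm.
by rewrite !paddr_eq0 ?addr_ge0 ?sqr_ge0// !sqrf_eq0 andbA.
Qed.

(** The equations hold also at zero field, where all three components of the
direction are [0]. *)
Lemma field_direction :
  [/\ Bx = bx Bx W * Bnorm Bx W, By W = by_ Bx W * Bnorm Bx W
    & Bz W = bz Bx W * Bnorm Bx W].
Proof.
have [/eqP|N0] := eqVneq (Bnorm Bx W) 0; last by rewrite /bx /by_ /bz !divfK.
by rewrite Bnorm_eq0 => /and3P[/eqP B1 /eqP B2 /eqP B3];
  rewrite /bx /by_ /bz B2 B3 {1 2}B1 !mul0r.
Qed.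

Lemma sqr_by_add_bz : Bnorm Bx W != 0 ->
  by_ Bx W ^+ 2 + bz Bx W ^+ 2 = 1 - bx Bx W ^+ 2.
Proof.
move=> N0; rewrite /bx /by_ /bz !expr_div_n sqr_Bnorm; field.
by rewrite -sqr_Bnorm expf_neq0.
Qed.

(** The speed of an Alfven wave that propagates along the magnetic field. *)
Definition aligned_speed : R :=
  Num.sqrt (Bnorm Bx W ^+ 2 / (4 * pi * rho W) - dp W / rho W).

Lemma P_M_sub_ppar : P_M Bx W - ppar W = Bnorm Bx W ^+ 2 / (4 * pi) - dp W.
Proof. rewrite /P_M /dp; ring. Qed.

(** The bound [ppar <= P_M] in [Omega] is what makes the Alfven speeds real. *)
Lemma aligned_speed_radicand :
  Bnorm Bx W ^+ 2 / (4 * pi * rho W) - dp W / rho W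
  = (P_M Bx W - ppar W) / rho W.
Proof.
by rewrite P_M_sub_ppar [in RHS]mulrBl -(mulrA _ (4 * pi)^-1) -invfM.
Qed.

Lemma c_a_radicand :
  Bx ^+ 2 / (4 * pi * rho W) - dp W * bx Bx W ^+ 2 / rho W
  = bx Bx W ^+ 2 * ((P_M Bx W - ppar W) / rho W).
Proof.
have [e _ _] := field_direction; rewrite -aligned_speed_radicand.
have -> : Bx ^+ 2 = bx Bx W ^+ 2 * Bnorm Bx W ^+ 2 by rewrite -exprMn -e.
ring.
Qed.

Lemma c_a_eq : c_a Bx W = `|bx Bx W| * aligned_speed.
Proof.
rewrite /c_a c_a_radicand -aligned_speed_radicand.
by rewrite sqrtrM ?sqr_ge0// sqrtr_sqr.
Qed.

(** In this form the anisotropy can be substituted away, leaving polynomial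
identities in the aligned speed instead of square roots. *)
Lemma dp_eq : Omega Bx W ->
  dp W = Bnorm Bx W ^+ 2 / (4 * pi) - rho W * aligned_speed ^+ 2.
Proof.
move=> [r0 _ _ /andP[_ pM]].
have -> : aligned_speed ^+ 2 = (P_M Bx W - ppar W) / rho W.
  rewrite /aligned_speed aligned_speed_radicand sqr_sqrtr//.
  by rewrite divr_ge0 ?subr_ge0// ltW.
rewrite [rho W * _]mulrC divfK ?gt_eqF// P_M_sub_ppar; ring.
Qed.

Lemma alfven_speed_Bx0 (s : R) : Bx = 0 -> alfven_speed s Bx W = ux W.
Proof.
move=> Bx0.
by rewrite /alfven_speed c_a_eq /bx Bx0 mul0r normr0 mul0r mulr0 addr0.
Qed.

(** * Eigenvectors of the CGL matrix *)

Lemma entropy_eigenvector :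
  right_eigenvector (cgl_matrix Bx W) (ux W) (R_entropy W).
Proof.
split; first by apply: (@vec8_neq0 _ _ 0); rewrite ?oner_eq0.
apply: mat8_eigenvector; do 8 (case=> [_|]; [by rewrite /=; ring|]); by [].
Qed.

Lemma anisotropy_eigenvector : Omega Bx W ->
  [|| By W != 0, Bz W != 0 | ppar W != P_M Bx W] ->
  right_eigenvector (cgl_matrix Bx W) (ux W) (R_anisotropy Bx W).
Proof.
move=> OW nz; have r0 : rho W != 0 by case: OW => /lt0r_neq0.
have pi0 : pi != 0 :> R by rewrite gt_eqF// pi_gt0.
split.
  (* If [By W = Bz W = 0] then [bx ^+ 2] is 0 (zero field) or 1, and the entry
     of index 4, respectively 5, is [ppar W - P_M Bx W]. *)
  have [By0|By0] := eqVneq (By W) 0; last exact: (@vec8_neq0 _ _ 6).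
  have [Bz0|Bz0] := eqVneq (Bz W) 0; last exact: (@vec8_neq0 _ _ 7).
  move: nz; rewrite By0 Bz0 eqxx/= => nz.
  have [N0|N0] := eqVneq (Bnorm Bx W) 0.
    apply: (@vec8_neq0 _ _ 4) => //=.
    rewrite /bx N0 invr0 mulr0 expr0n subr0 mul1r.
    by rewrite subr_eq0; move: nz; rewrite /P_M N0 expr0n mul0r add0r.
  apply: (@vec8_neq0 _ _ 5) => //=.
  have := sqr_by_add_bz N0.
  rewrite /by_ /bz By0 Bz0 !mul0r expr0n addr0 => /eqP.
  rewrite eq_sym subr_eq0 => /eqP <-.
  by rewrite mul1r -opprB -P_M_sub_ppar oppr_eq0 subr_eq0 eq_sym.
apply: mat8_eigenvector.
have [N0|N0] := eqVneq (Bnorm Bx W) 0.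
  have := N0; move/eqP; rewrite Bnorm_eq0 => /and3P[/eqP B1 /eqP B2 /eqP B3].
  rewrite /bx /by_ /bz N0 invr0 !mulr0 B1 B2 B3.
  do 8 (case=> [_|]; [by rewrite /=; ring|]); by [].
have [] := field_direction; have := sqr_by_add_bz N0.
move: (bx Bx W) (by_ Bx W) (bz Bx W) (By W) (Bz W) (Bnorm Bx W) N0.
move=> x y z Y Z N N0 yz Bxe -> ->.
have xe : x ^+ 2 = 1 - y ^+ 2 - z ^+ 2 by rewrite -addrA -opprD yz; ring.
move: (rho W) r0 (pi : R) pi0 => r r0 p p0.
do 8 (case=> [_|]; [rewrite /= ?Bxe; field: xe; rewrite ?N0 ?r0 ?p0//|]); by [].
Qed.

Lemma alfven_eigenvector (s : R) : s = 1 \/ s = -1 -> Omega Bx W ->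
  (By W != 0) || (Bz W != 0) ->
  right_eigenvector (cgl_matrix Bx W) (alfven_speed s Bx W) (R_alfven s Bx W).
Proof.
move=> s1 OW nz; split.
  case/orP: nz => ?; first exact: (@vec8_neq0 _ _ 7).
  by apply: (@vec8_neq0 _ _ 6); rewrite //= oppr_eq0.
have N0 : Bnorm Bx W != 0 by rewrite Bnorm_eq0 negb_and negb_and nz orbT.
have r0 : rho W != 0 by case: OW => /lt0r_neq0.
have pi0 : pi != 0 :> R by rewrite gt_eqF// pi_gt0.
have ss : s ^+ 2 = 1 by case: s1 => ->; ring.
(* The entries of [R_alfven] contain [Num.sg Bx], those of the speed `|bx|: the
   two are related through [bx = Num.sg bx * `|bx|]. *)
have sgBx : Num.sg Bx = Num.sg (bx Bx W).
  rewrite /bx sgrM sgrV (gtr0_sg (x := Bnorm _ _)) ?mulr1//.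
  by rewrite lt0r N0 sqrtr_ge0.
have De := dp_eq OW.
apply: mat8_eigenvector; rewrite /alfven_speed c_a_eq sgBx.
rewrite -/aligned_speed.
have xe := numEsg (bx Bx W); have ne := normrEsg (bx Bx W).
have [] := field_direction; have := sqr_by_add_bz N0.
have ge : Num.sg (bx Bx W) ^+ 2 * `|bx Bx W| = `|bx Bx W|.
  by rewrite expr2 -mulrA -xe -ne.
move: (Num.sg _) `|bx Bx W| aligned_speed ge xe De {ne} => g n c ge xe De.
move: (bx Bx W) (by_ Bx W) (bz Bx W) (By W) (Bz W) (Bnorm Bx W) N0 xe De.
move=> x y z Y Z N N0 -> De yz Bxe -> ->.
have {}yz : y ^+ 2 = 1 - z ^+ 2 - (g * n) ^+ 2 by rewrite -addrAC -yz; ring.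
move: (rho W) r0 (pi : R) pi0 De => r r0 p p0 ->.
do 8 (case=> [_|];
  [rewrite /= ?Bxe; field: ss ge yz; rewrite ?N0 ?r0 ?p0//|]); by [].
Qed.

(** For a nonzero field along the x-axis, the Alfven wave may be polarized in
any transverse direction; the vector used here is polarized along y. If the
whole field is zero then [c_a = 0] and the entropy eigenvector serves. *)
Lemma alfven_eigenvalue (s : R) : s = 1 \/ s = -1 -> Omega Bx W ->
  eigenvalue (cgl_matrix Bx W)^T (alfven_speed s Bx W).
Proof.
move=> s1 OW.
have [nz|] := boolP ((By W != 0) || (Bz W != 0)).
  exact: (eigenvalue_tr _ _ _ _ (alfven_eigenvector s s1 OW nz)).
rewrite negb_or !negbK => /andP[/eqP By0 /eqP Bz0].
have [Bx0|Bx0] := eqVneq Bx 0.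
  rewrite alfven_speed_Bx0//.
  exact: (eigenvalue_tr _ _ _ _ entropy_eigenvector).
have N0 : Bnorm Bx W != 0 by rewrite Bnorm_eq0 negb_and Bx0.
have r0 : rho W != 0 by case: OW => /lt0r_neq0.
have pi0 : pi != 0 :> R by rewrite gt_eqF// pi_gt0.
have ss : s ^+ 2 = 1 by case: s1 => ->; ring.
have cc : c_a Bx W ^+ 2 = bx Bx W ^+ 2 * aligned_speed ^+ 2.
  by rewrite c_a_eq exprMn real_normK ?num_real.
have De := dp_eq OW.
apply: (eigenvalue_tr _ _ _ (vec8 [:: 0; 0; - (s * c_a Bx W); 0; 0; 0; Bx; 0])).
split; first exact: (@vec8_neq0 _ _ 6).
apply: mat8_eigenvector; rewrite /alfven_speed /by_ /bz By0 Bz0 !mul0r.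
have [Bxe _ _] := field_direction.
move: (c_a Bx W) (bx Bx W) (Bnorm Bx W) aligned_speed N0 Bxe cc De.
move=> c x N d N0 Bxe cc De.
move: (rho W) r0 (pi : R) pi0 De => r r0 p p0 ->.
do 8 (case=> [_|];
  [rewrite /= ?Bxe; field: ss cc; rewrite ?N0 ?r0 ?p0//|]); by [].
Qed.

End Field.

(** * Differentiability of the Alfven speed *)

Section Speed.
Context (R : realType) (Bx : R).

Lemma differentiable_comp_sqrt (V : normedModType R) (f : V -> R) (a : V) :
  0 < f a -> differentiable f a -> differentiable (fun x => Num.sqrt (f x)) a.
Proof.
move=> fa0 df; apply: (differentiable_comp df).
by apply/derivable1_diffP; have [] := is_derive1_sqrt fa0.
Qed.

Lemma differentiable_entry i (W : 'cV[R]_8) :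
  differentiable (fun W : 'cV[R]_8 => W i 0 : R) W.
Proof. exact: differentiable_coord. Qed.

Lemma differentiable_Bnorm (W : 'cV[R]_8) :
  Bnorm Bx W != 0 -> differentiable (Bnorm Bx) W.
Proof.
move=> N0; apply: differentiable_comp_sqrt.
  by rewrite -sqr_Bnorm exprn_even_gt0.
have sqrd i : differentiable (fun V : 'cV[R]_8 => V i 0 ^+ 2) W.
  have di := differentiable_entry i W; exact: (differentiableM di di).
apply: differentiableD; last exact: sqrd.
by apply: differentiableD; [exact: differentiable_cst | exact: sqrd].
Qed.

Lemma differentiable_alfven_speed (s : R) (W : 'cV[R]_8) :
  Omega Bx W -> (Bx != 0 -> ppar W < P_M Bx W) ->
  differentiable (alfven_speed s Bx) W.
Proof.
move=> OW pM; have [Bx0|Bx0] := eqVneq Bx 0.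
  have -> : alfven_speed s Bx = @ux R.
    by apply/funext => V; exact: alfven_speed_Bx0.
  exact: differentiable_entry.
have N0 : Bnorm Bx W != 0 by rewrite Bnorm_eq0 negb_and Bx0.
have r0 : 0 < rho W by case: OW.
have pi0 : 0 < pi :> R by exact: pi_gt0.
have dV (f : 'cV[R]_8 -> R) : differentiable f W -> f W != 0 ->
  differentiable (fun V => (f V)^-1) W by exact: differentiableV.
have dr : differentiable (@rho R) W by exact: differentiable_entry.
apply: differentiableD; first exact: differentiable_entry.
apply: differentiableM; first exact: differentiable_cst.
apply: differentiable_comp_sqrt.
  rewrite c_a_radicand.
  rewrite mulr_gt0 ?divr_gt0 ?subr_gt0 ?pM//.
  by rewrite exprn_even_gt0//= /bx mulf_neq0 ?invr_neq0.
apply: differentiableB.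
  apply: differentiableM; first exact: differentiable_cst.
  apply: dV; last by rewrite !mulf_neq0 ?gt_eqF.
  by apply: differentiableM; first exact: differentiable_cst.
apply: differentiableM; last by apply: dV; rewrite ?gt_eqF.
have db : differentiable (bx Bx) W.
  apply: differentiableM; first exact: differentiable_cst.
  by apply: dV => //; exact: differentiable_Bnorm.
apply: differentiableM; last exact: (differentiableM db db).
by apply: differentiableB; exact: differentiable_entry.
Qed.

(** * Linear degeneracy *)

Lemma alfven_speed_eq (s : R) (W W' : 'cV[R]_8) :
  rho W = rho W' -> ux W = ux W' -> dp W = dp W' ->
  By W ^+ 2 + Bz W ^+ 2 = By W' ^+ 2 + Bz W' ^+ 2 ->
  alfven_speed s Bx W = alfven_speed s Bx W'.
Proof.
move=> er eu ed eB; have eN : Bnorm Bx W = Bnorm Bx W'.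
  by rewrite /Bnorm -!addrA eB.
by rewrite /alfven_speed /c_a /bx er eu ed eN.
Qed.

Lemma linearly_degenerate_ux (Rv : 'cV[R]_8 -> 'cV[R]_8) :
  (forall W, ux (Rv W) = 0) -> linearly_degenerate Bx (@ux R) Rv.
Proof.
move=> uR W _; rewrite gradient_mulmx; last exact: differentiable_entry.
rewrite derive_even ?raddf0//; first exact: differentiable_entry.
by move=> h; rewrite /ux !mxE -/(ux _) uR mulr0 oppr0.
Qed.

(** Moving by [h] and by [- h] along the eigenvector rotates [(By, Bz)] in
opposite senses and stretches it equally, so the speed is even in [h]. *)
Lemma alfven_degenerate_smooth (s : R) (W : 'cV[R]_8) :
  differentiable (alfven_speed s Bx) W ->
  gradient (alfven_speed s Bx) W *m R_alfven s Bx W = 0.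
Proof.
move=> dl; rewrite gradient_mulmx// derive_even ?raddf0// => h.
apply: alfven_speed_eq;
  rewrite /R_alfven /rho /ux /dp /ppar /pperp /By /Bz !mxE /=; ring.
Qed.

(** Where [ppar = P_M] the quantity [c_a] vanishes, so along a line on which
[ux] is constant the speed has a minimum (for [s = 1]) or a maximum (for
[s = -1]). *)
Lemma alfven_derive_boundary (s : R) (W v : 'cV[R]_8) :
  s = 1 \/ s = -1 -> ppar W = P_M Bx W -> ux v = 0 ->
  'D_v (alfven_speed s Bx) W = 0.
Proof.
move=> s1 pM uv.
have lam_ux h : alfven_speed s Bx (h *: v + W) - alfven_speed s Bx W =
    s * c_a Bx (h *: v + W).
  rewrite /alfven_speed [c_a Bx W]c_a_eq /aligned_speed.
  rewrite aligned_speed_radicand pM subrr mul0r sqrtr0.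
  by rewrite /ux !mxE -!/(ux _) uv; ring.
case: s1 => ss; move: lam_ux; rewrite ss => lam_ux.
  by apply: derive_at_min => h; rewrite -subr_ge0 lam_ux mul1r sqrtr_ge0.
apply: derive_eq0_of_derivable => df.
apply/eqP; rewrite -oppr_eq0 -deriveN//; apply/eqP.
apply: derive_at_min => h; rewrite lerN2.
by rewrite -subr_le0 lam_ux mulN1r oppr_le0 sqrtr_ge0.
Qed.

Lemma alfven_degenerate (s : R) : s = 1 \/ s = -1 ->
  linearly_degenerate Bx (alfven_speed s Bx) (R_alfven s Bx).
Proof.
move=> s1 W OW; have [pM|pM] := eqVneq (ppar W) (P_M Bx W); last first.
  apply/alfven_degenerate_smooth/differentiable_alfven_speed => // _.
  by rewrite lt_neqAle pM; case: OW => _ _ _ /andP[].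
(* The speed need not be differentiable here: the sum is zero term by term. *)
apply/matrixP => i j; rewrite !mxE big1// => k _; rewrite !mxE.
have [k1|k1] := eqVneq k (@Ordinal 8 1 isT).
  by rewrite k1 /= mulr0.
by rewrite alfven_derive_boundary ?mul0r// /ux mxE eq_sym (negPf k1).
Qed.

End Speed.

(* [eigenvalue] is about row vectors, hence the transposes. The vector
   R_anisotropy vanishes exactly when By = Bz = 0 and p_par = P_M, and R_alfven
   exactly when By = Bz = 0. *)
Theorem lemma2p1 (R : realType) (Bx : R) :
  [/\ (* entropy wave *)
      [/\ forall W, Omega Bx W -> eigenvalue (cgl_matrix Bx W)^T (ux W),
          forall W, Omega Bx W ->
            right_eigenvector (cgl_matrix Bx W) (ux W) (R_entropy W),
          forall W, Omega Bx W -> differentiable (@ux R) W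
        & linearly_degenerate Bx (@ux R) (@R_entropy R)],
      (* pressure anisotropy wave *)
      [/\ forall W, Omega Bx W -> eigenvalue (cgl_matrix Bx W)^T (ux W),
          forall W, Omega Bx W ->
            [|| By W != 0, Bz W != 0 | ppar W != P_M Bx W] ->
            right_eigenvector (cgl_matrix Bx W) (ux W) (R_anisotropy Bx W),
          forall W, Omega Bx W -> differentiable (@ux R) W
        & linearly_degenerate Bx (@ux R) (R_anisotropy Bx)]
    & (* Alfven waves *)
      forall s : R, s = 1 \/ s = -1 ->
      [/\ forall W, Omega Bx W ->
            eigenvalue (cgl_matrix Bx W)^T (alfven_speed s Bx W),
          forall W, Omega Bx W -> (By W != 0) || (Bz W != 0) ->
            right_eigenvector (cgl_matrix Bx W) (alfven_speed s Bx W)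
              (R_alfven s Bx W),
          forall W, Omega Bx W -> (Bx != 0 -> ppar W < P_M Bx W) ->
            differentiable (alfven_speed s Bx) W
        & linearly_degenerate Bx (alfven_speed s Bx) (R_alfven s Bx)]].
Proof.
have eig_ux W : eigenvalue (cgl_matrix Bx W)^T (ux W).
  exact: (eigenvalue_tr _ _ _ _ (entropy_eigenvector _ Bx W)).
have diff_ux (W : 'cV[R]_8) : differentiable (@ux R) W.
  exact: differentiable_entry.
split; first split=> //.
- by move=> W _; exact: entropy_eigenvector.
- by apply: linearly_degenerate_ux => W; rewrite /ux mxE.
- split=> //; first by move=> W; exact: anisotropy_eigenvector.
  by apply: linearly_degenerate_ux => W; rewrite /ux mxE.
- move=> s s1; split.
  + by move=> W; exact: alfven_eigenvalue.
  + by move=> W; exact: alfven_eigenvector.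
  + by move=> W; exact: differentiable_alfven_speed.
  + exact: alfven_degenerate.
Qed.
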